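(* Let $d\ge4$ be an even integer, $k\in\mathbb{N}$ with $p:=k-\frac d2\in\mathbb{N}_0$, and let $\mathbf{x},\mathbf{x}'\in\mathbb{R}^d$ with $r=\|\mathbf{x}\|>0$, $r'=\|\mathbf{x}'\|>0$, $r\neq r'$. Then $$\|\mathbf{x}-\mathbf{x}'\|^{2k-d}=i(-1)^{p-\frac d2}\,\frac{2^{\frac{d-1}{2}}}{\sqrt\pi}\,p!\,\bigl(\tfrac d2-2\bigr)!\,(2rr')^p\left(\frac{r_>^2-r_<^2}{2rr'}\right)^{p+\frac{d-1}{2}}\sum_{n=0}^p\frac{(-1)^n(n+\frac d2-1)\,C_n^{\frac d2-1}(\cos\gamma)}{(p-n)!(n+p+d-2)!}\,Q_{n+\frac{d-3}{2}}^{p+\frac{d-1}{2}}(\zeta).$$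
   Context: $\mathbb{N}=\{1,2,\ldots\}$, $\mathbb{N}_0=\{0\}\cup\mathbb{N}$; $\|\cdot\|$ is the Euclidean norm; $r_>=\max\{r,r'\}$, $r_<=\min\{r,r'\}$; $\zeta=\frac{r^2+r'^2}{2rr'}$; $\gamma\in[0,\pi]$ is the separation angle, $\cos\gamma=\frac{(\mathbf{x},\mathbf{x}')}{rr'}$ with $(\cdot,\cdot)$ the Euclidean inner product. $C_n^\mu$ is the Gegenbauer polynomial. For $z>1$ the associated Legendre function of the second kind is $$Q_\nu^\mu(z)=\frac{\sqrt{\pi}\,e^{i\pi\mu}\,\Gamma(\nu+\mu+1)(z^2-1)^{\mu/2}}{2^{\nu+1}\Gamma(\nu+\frac32)z^{\nu+\mu+1}}\,{}_2F_1\!\left(\tfrac{\nu+\mu+1}{2},\tfrac{\nu+\mu+2}{2};\nu+\tfrac32;\tfrac1{z^2}\right).$$ *)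

(* Defs.v *)
From HB Require Import structures.
From mathcomp Require Import all_boot all_order all_algebra.
From mathcomp Require Import complex.
From mathcomp Require Import all_classical all_reals all_analysis.

Set Implicit Arguments.
Unset Strict Implicit.
Unset Printing Implicit Defensive.

Import Order.TTheory GRing.Theory Num.Theory.
Import numFieldNormedType.Exports.

Local Open Scope complex_scope.
Local Open Scope ring_scope.

Section SpecialFunctions.
Context {R : realType}.

Definition dotp (d : nat) (x y : 'rV[R]_d) : R := \sum_(i < d) x 0 i * y 0 i.

(* The canonical norm `|x| on row vectors is the sup norm. *)
Definition enorm (d : nat) (x : 'rV[R]_d) : R := Num.sqrt (dotp x x).

(* Rising factorial a (a + 1) ... (a + n - 1). *)
Definition pochhammer (a : R) (n : nat) : R := \prod_(j < n) (a + j%:R).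

(* Euler-Gauss limit n! n^x / (x (x + 1) ... (x + n)); it gives the Gamma
   function at every real x except the poles 0, -1, -2, ..., where the value
   is 0 because 0^-1 = 0. *)
Definition Gamma (x : R) : R :=
  limn (fun n : nat => n`!%:R * n%:R `^ x / pochhammer x n.+1).

(* Meaningful when |z| < 1 and c is not 0, -1, -2, ... *)
Definition hyp2F1 (a b c z : R) : R :=
  limn (series (fun n : nat =>
    pochhammer a n * pochhammer b n / (pochhammer c n * n`!%:R) * z ^+ n)).

(* C_n^mu (X) = \sum_(j <= n/2)
     (-1)^j (mu)_(n - j) / (j! (n - 2 j)!) (2 X)^(n - 2 j). *)
Definition gegenbauer (n : nat) (mu : R) : {poly R} :=
  \sum_(j < (n./2).+1)
    ((-1) ^+ j * pochhammer mu (n - j) / (j`! * (n - 2 * j)`!)%:R)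
      *: (2 *: 'X) ^+ (n - 2 * j).

(* exp (i t) *)
Definition cis (t : R) : R[i] := cos t +i* sin t.

(* Associated Legendre function of the second kind, for real degree nu, real
   order mu and z > 1; the factor exp (i pi mu) makes it complex-valued. *)
Definition legendreQ (nu mu z : R) : R[i] :=
  cis (pi * mu) *
  (Num.sqrt pi * Gamma (nu + mu + 1) * (z ^+ 2 - 1) `^ (mu / 2)
   / (2 `^ (nu + 1) * Gamma (nu + 3 / 2) * z `^ (nu + mu + 1))
   * hyp2F1 ((nu + mu + 1) / 2) ((nu + mu + 2) / 2) (nu + 3 / 2)
       (1 / z ^+ 2))%:C.

End SpecialFunctions.

(* Main.v *)
Require Import Defs.
From HB Require Import structures.
From mathcomp Require Import all_boot all_order all_algebra.
From mathcomp Require Import complex.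
From mathcomp Require Import all_classical all_reals all_analysis.
From mathcomp Require Import ring lra zify.

Set Implicit Arguments.
Unset Strict Implicit.
Unset Printing Implicit Defensive.

Import Order.TTheory GRing.Theory Num.Theory.
Import numFieldNormedType.Exports.

Local Open Scope complex_scope.
Local Open Scope ring_scope.

(* With w = 1 / zeta^2, mu = p + (d - 1) / 2 and q = p - n, Euler's
   transformation turns the 2F1 in Q_{n + (d - 3) / 2}^mu (zeta) into
   (1 - w)^(- mu) times a polynomial of degree q / 2 in w. All non-integral
   powers then cancel against the prefactor, and the phases cancel as well.
   Since |x - x'|^2 = 2 r r' (zeta - cos gamma), what remains is the
   polynomial identity obtained by expanding (zeta - X)^p binomially and each
   X^N in the Gegenbauer polynomials C_{N - 2 j}^(d / 2 - 1) (X). *)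

(** * Rising factorials *)

Lemma pochhammer0 (R : realType) (a : R) : pochhammer a 0 = 1.
Proof. by rewrite /pochhammer big_ord0. Qed.

Lemma pochhammerSr (R : realType) (a : R) n :
  pochhammer a n.+1 = pochhammer a n * (a + n%:R).
Proof. by rewrite /pochhammer big_ord_recr. Qed.

Lemma pochhammerSl (R : realType) (a : R) n :
  pochhammer a n.+1 = a * pochhammer (a + 1) n.
Proof.
rewrite /pochhammer big_ord_recl addr0; congr (_ * _).
by apply: eq_bigr => i _; rewrite -addrA -natr1 [1 + _]addrC.
Qed.

Lemma pochhammer_gt0 (R : realType) (a : R) n : 0 < a -> 0 < pochhammer a n.
Proof. by move=> a0; apply: prodr_gt0 => i _; rewrite ltr_wpDr. Qed.

Lemma pochhammer_natS (R : realType) (l k : nat) :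
  pochhammer l.+1%:R k = (l + k)`!%:R / l`!%:R :> R.
Proof.
have fn0 : l`!%:R != 0 :> R by rewrite pnatr_eq0 -lt0n fact_gt0.
elim: k => [|k IH]; first by rewrite pochhammer0 addn0 mulfV.
by rewrite pochhammerSr IH addnS factS natrM -addSn natrD; ring.
Qed.

(** The factors of even and of odd index on the left are twice the factors of the two products on
    the right. This merges the upper parameters [A / 2] and [(A + 1) / 2] of a 2F1 into one rising
    factorial. *)
Lemma pochhammer_double (R : realType) (a : R) n :
  pochhammer (2 * a) n.*2 = 4 ^+ n * pochhammer a n * pochhammer (a + 1 / 2) n.
Proof.
elim: n => [|n IH]; first by rewrite !pochhammer0 expr0 !mulr1.
rewrite doubleS !pochhammerSr IH exprS -natr1 -muln2 natrM; by field.
Qed.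

Lemma pochhammer_oppn (R : realType) q n : (n <= q)%N ->
  pochhammer (- q%:R) n = (-1) ^+ n * q`!%:R / (q - n)`!%:R :> R.
Proof.
have fn0 k : k`!%:R != 0 :> R by rewrite pnatr_eq0 -lt0n fact_gt0.
elim: n => [|n IH] nq; first by rewrite pochhammer0 subn0 expr0 mul1r mulfV.
rewrite pochhammerSr IH ?(ltnW nq) // exprS.
have [m qE] : exists m, q = (n + m).+1 by exists (q - n.+1)%N; lia.
rewrite qE (_ : (n + m).+1 - n = m.+1)%N; last by lia.
rewrite (_ : (n + m).+1 - n.+1 = m)%N; last by lia.
rewrite (factS m) natrM.
have : m.+1%:R != 0 :> R by rewrite pnatr_eq0.
rewrite -!natr1 natrD => m0; field.
by rewrite m0 !fn0.
Qed.

Lemma pochhammer_oppn_eq0 (R : realType) q n : (q < n)%N ->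
  pochhammer (- q%:R) n = 0 :> R.
Proof.
move=> qn; apply/eqP/prodf_eq0; exists (Ordinal qn) => //=.
by rewrite addNr.
Qed.

(** * The binomial series *)

Section BinomialSeries.
Local Open Scope classical_set_scope.
Context {R : realType}.
Implicit Types mu w : R.

Definition binomial_term mu w (n : nat) : R := pochhammer mu n / n`!%:R * w ^+ n.

(* The recurrence k c_k = (mu + k - 1) c_(k - 1) of the coefficients cancels all
   terms of the derivative but the last. *)
Lemma is_derive_binomial_sum mu N w : w < 1 ->
  is_derive w 1 (fun v => series (binomial_term mu v) N.+1 * (1 - v) `^ mu)
   (- (pochhammer mu N.+1 / N`!%:R * w ^+ N * (1 - w) `^ (mu - 1))).
Proof.
move=> w1.
have w1' : 0 < 1 - w by lra.
have dpow : is_derive w 1 (fun v => (1 - v) `^ mu) (- (mu * (1 - w) `^ (mu - 1))).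
  have dsub : is_derive w 1 (fun v : R => 1 - v) (-1).
    by apply: is_derive_eq; rewrite add0r mul1r.
  have := @is_derive1_comp _ (fun v => v `^ mu) (fun v => 1 - v) w _ _
    (is_derive1_powR mu w1') dsub.
  by rewrite mulrN1.
have E : (1 - w) `^ mu = (1 - w) * (1 - w) `^ (mu - 1).
  rewrite -{2}(powRr1 (ltW w1')) -powRD; last by apply/implyP => _; rewrite gt_eqF.
  by congr (_ `^ _); lra.
have dmon k : is_derive w 1 (fun v : R => v ^+ k) (k%:R * w ^+ k.-1).
  have := @is_deriveX _ _ id k w 1 1 (is_derive_id _ _).
  rewrite [X in is_derive _ _ X](_ : _ = fun v : R => v ^+ k).
    by rewrite /GRing.scale /= mulr1.
  by apply/funext => v; rewrite exprfctE.
elim: N => [|N IH].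
  rewrite pochhammerSr pochhammer0 mul1r addr0 fact0 divr1 expr0 mulr1.
  rewrite [X in is_derive _ _ X _](_ : _ = fun v => (1 - v) `^ mu) //.
  apply/funext => v.
  rewrite seriesSr /series/= big_geq// /binomial_term pochhammer0 fact0 expr0.
  by rewrite add0r divr1 !mul1r.
rewrite [X in is_derive _ _ X _](_ : _ =
   (fun v => series (binomial_term mu v) N.+1 * (1 - v) `^ mu) +
   (fun v : R => v ^+ N.+1) * (fun v => (1 - v) `^ mu) *
     cst (pochhammer mu N.+1 / N.+1`!%:R)); last first.
  apply/funext => v /=.
  rewrite seriesSr {2}/binomial_term mulrDl; congr (_ + _).
  by rewrite !fctE; ring.
apply: is_derive_eq.
rewrite /= !fctE /GRing.scale /= E (pochhammerSr _ N.+1) factS natrM exprS.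
have := fact_gt0 N; rewrite -(ltr0n R) => f0.
rewrite -natr1; field.
by rewrite (gt_eqF f0) natr1 pnatr_eq0.
Qed.

(** The function differentiated in [is_derive_binomial_sum] equals 1 at 0, so the mean value theorem
    on [0, w] yields an exact remainder. *)
Lemma binomial_sum_MVT mu N w : 0 < w < 1 ->
  exists2 x, 0 < x < w & series (binomial_term mu w) N.+1 * (1 - w) `^ mu =
   1 - pochhammer mu N.+1 / N`!%:R * x ^+ N * (1 - x) `^ (mu - 1) * w.
Proof.
move=> /andP[w0 w1].
pose f v := series (binomial_term mu v) N.+1 * (1 - v) `^ mu.
have f0 : f 0 = 1.
  rewrite /f subr0 powR1 mulr1 /series/= big_nat_recl // big1 ?addr0.
    by rewrite /binomial_term pochhammer0 fact0 expr0 divr1 mulr1.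
  by move=> i _; rewrite /binomial_term expr0n mulr0.
have [||x] := @MVT R f
   (fun x => - (pochhammer mu N.+1 / N`!%:R * x ^+ N * (1 - x) `^ (mu - 1))) 0 w w0.
- by move=> x; rewrite in_itv/= => /andP[_ xw]; apply: is_derive_binomial_sum; lra.
- apply: derivable_within_continuous => x; rewrite in_itv/= => /andP[_ xw].
  have x1 : x < 1 by lra.
  by have [] := is_derive_binomial_sum mu N x1.
- rewrite in_itv/= f0 subr0 => xw fE; exists x => //.
  by rewrite -/(f w) -[LHS](subrK 1) fE; ring.
Qed.

(** The partial sums times (1 - w)^mu are squeezed between 1 minus a geometric sequence and 1. *)
Lemma cvg_binomial_series mu w : 1 <= mu -> 0 < w < 1 ->
  series (binomial_term mu w) n @[n --> \oo] --> (1 - w) `^ (- mu).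
Proof.
move=> mu1 w01; have /andP[w0 w1] := w01.
pose v := (w + 1) / 2.
have v01 : 0 < v < 1 by rewrite /v; apply/andP; split; lra.
have wv : w < v by rewrite /v; lra.
have /andP[v0 v1] := v01.
have Pw : 0 < (1 - w) `^ mu by rewrite powR_gt0 //; lra.
have Pv : 0 < (1 - v) `^ (mu + 1) by rewrite powR_gt0 //; lra.
have f0 N : (0 : R) < N`!%:R by rewrite ltr0n fact_gt0.
have term0 m u n : 0 < m -> 0 < u -> 0 <= binomial_term m u n.
  by move=> m0 u0; rewrite /binomial_term mulr_ge0 ?divr_ge0 ?exprn_ge0 ?ltW ?pochhammer_gt0.
(* The remainder at w involves the N-th term of the series of exponent mu + 1,
   which is bounded at any v > w and hence decays geometrically at w. *)
have bound N : binomial_term (mu + 1) v N <= ((1 - v) `^ (mu + 1))^-1.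
  have [x /andP[x0 xv] E] := binomial_sum_MVT (mu + 1) N v01.
  rewrite -[leRHS]mul1r ler_pdivlMr //.
  (* All terms are nonnegative, so the last one is at most the partial sum, whose product with (1 -
     v)^(mu + 1) is 1 minus a nonnegative remainder. *)
  apply: (@le_trans _ _ (series (binomial_term (mu + 1) v) N.+1 * (1 - v) `^ (mu + 1))).
    rewrite ler_wpM2r ?(ltW Pv)// seriesSr lerDr.
    by rewrite /series/= sumr_ge0 // => i _; apply: term0 => //; lra.
  rewrite E gerBl mulr_ge0 ?(ltW v0) // mulr_ge0 ?powR_ge0 // mulr_ge0 ?exprn_ge0 ?(ltW x0)//.
  by rewrite divr_ge0 ?ler0n// ltW// pochhammer_gt0//; lra.
pose C := mu * w * ((1 - v) `^ (mu + 1))^-1.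
have main N : 1 - C * (w / v) ^+ N <= series (binomial_term mu w) N.+1 * (1 - w) `^ mu <= 1.
  have [x /andP[x0 xw] ->] := binomial_sum_MVT mu N w01.
  have A0 : 0 <= pochhammer mu N.+1 / N`!%:R.
    by rewrite divr_ge0 ?ler0n// ltW// pochhammer_gt0//; lra.
  apply/andP; split; last first.
    by rewrite gerBl mulr_ge0 ?(ltW w0) // mulr_ge0 ?powR_ge0 // mulr_ge0 ?exprn_ge0 ?(ltW x0).
  apply: lerB => //.
  (* Enlarge x^N to w^N and (1 - x)^(mu - 1) to 1; the latter uses [1 <= mu]. *)
  apply: (@le_trans _ _ (pochhammer mu N.+1 / N`!%:R * w ^+ N * 1 * w)).
    apply: ler_wpM2r; first exact: ltW.
    apply: ler_pM.
    - by rewrite mulr_ge0 ?exprn_ge0 ?(ltW x0).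
    - exact: powR_ge0.
    - by rewrite ler_wpM2l// lerXn2r ?nnegrE ?ltW.
    - have p1 : 1 `^ (mu - 1) = 1 :> R by rewrite powR1.
      by rewrite -[leRHS]p1; apply: ge0_ler_powR; rewrite ?nnegrE; lra.
  (* Splitting off the first factor of the rising factorial raises the exponent to [mu + 1], and w^N
     = (w / v)^N v^N. *)
  have -> : pochhammer mu N.+1 / N`!%:R * w ^+ N * 1 * w =
      mu * w * (w / v) ^+ N * binomial_term (mu + 1) v N.
    rewrite /binomial_term pochhammerSl expr_div_n; field.
    by rewrite !gt_eqF ?exprn_gt0.
  rewrite /C [leRHS]mulrAC ler_wpM2l// mulr_ge0 ?mulr_ge0 ?exprn_ge0 ?divr_ge0 ?ltW//; lra.
rewrite -cvg_shiftS powRN.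
have -> : [sequence series (binomial_term mu w) n.+1]_n =
   (fun n => series (binomial_term mu w) n.+1 * (1 - w) `^ mu * ((1 - w) `^ mu)^-1).
  by apply/funext => n /=; rewrite mulfK// gt_eqF.
suff h : (series (binomial_term mu w) n.+1 * (1 - w) `^ mu) @[n --> \oo] --> (1 : R).
  have := cvgMl (b := ((1 - w) `^ mu)^-1) h; rewrite mul1r; apply.
have wv1 : `|w / v| < 1.
  rewrite ger0_norm; last by rewrite divr_ge0 ?ltW.
  by rewrite ltr_pdivrMr// mul1r.
have lower : (1 - C * (w / v) ^+ N) @[N --> \oo] --> (1 : R).
  have : (1 - C * (w / v) ^+ N) @[N --> \oo] --> 1 - C * 0.
    apply: cvgB; first exact: cvg_cst.
    by apply: cvgMr; apply: cvg_expr.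
  by rewrite mulr0 subr0.
apply: (squeeze_cvgr _ lower (cvg_cst (1 : R))).
by near=> N; exact: main.
Unshelve. all: by end_near.
Qed.
End BinomialSeries.

(** * Euler's transformation in the terminating case *)

Section EulerTransformation.
Local Open Scope classical_set_scope.
Context {R : realType}.
Implicit Types A c w : R.

Lemma cvg_series_finite (u : R^nat) K :
  (forall i, (K <= i)%N -> u i = 0) ->
  series u n @[n --> \oo] --> \sum_(0 <= i < K) u i.
Proof.
move=> u0; apply: cvg_near_cst; near=> n.
have Kn : (K <= n)%N by near: n; exact: nbhs_infty_ge.
rewrite /series /= (big_cat_nat (n := K)) //= -[RHS]addr0; congr (_ + _).
by rewrite big_nat_cond big1 // => i /andP[/andP[Ki _] _]; exact: u0.
Unshelve. all: by end_near.
Qed.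

(* The general term of 2F1 (A / 2, (A + 1) / 2; c; w). *)
Definition quad_term A c w i : R :=
  pochhammer A i.*2 / (4 ^+ i * pochhammer c i * i`!%:R) * w ^+ i.

Lemma quad_term0 A c w : quad_term A c w 0 = 1.
Proof. by rewrite /quad_term !pochhammer0 fact0 !expr0 !mulr1 divr1. Qed.

(** Once [pochhammer (A + 1) i.*2] and [pochhammer (c + 1) i] are factored out of all three terms, a
    rational identity remains. The bound on [c] keeps every denominator nonzero. *)
Lemma quad_term_contiguous A c w i : 1 < c ->
  quad_term (A - 1) (c - 1) w i.+1 = quad_term A c w i.+1 +
   (A + 1 - 2 * c) * A / (4 * c * (c - 1)) * w * quad_term (A + 1) (c + 1) w i.
Proof.
move=> c1; rewrite /quad_term doubleS.
have fn0 : i`!%:R != 0 :> R by rewrite pnatr_eq0 -lt0n fact_gt0.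
rewrite (pochhammerSl (A - 1)) subrK (pochhammerSl A) (pochhammerSl A).
rewrite (pochhammerSr (A + 1)) (pochhammerSl (c - 1)) subrK.
have c0 : c != 0 by rewrite gt_eqF //; lra.
have cm1 : c - 1 != 0 by rewrite gt_eqF //; lra.
have ci : c + i%:R != 0 by rewrite gt_eqF // ltr_wpDr //; lra.
have pc : pochhammer (c + 1) i != 0 by rewrite gt_eqF // pochhammer_gt0 //; lra.
have -> : pochhammer c i = c * pochhammer (c + 1) i / (c + i%:R).
  by rewrite -pochhammerSl pochhammerSr mulfK.
rewrite (pochhammerSl c) factS natrM -muln2 natrM !exprS.
have : i.+1%:R != 0 :> R by rewrite pnatr_eq0.
rewrite -natr1 => i0; field.
by rewrite i0 fn0 pc ci c0 cm1 expf_neq0 ?pnatr_eq0.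
Qed.

Lemma cvg_quad_contiguous A c w (k l1 l2 : R) : 1 < c ->
  4 * c * (c - 1) * k = (A + 1 - 2 * c) * A ->
  series (quad_term A c w) n @[n --> \oo] --> l1 ->
  series (quad_term (A + 1) (c + 1) w) n @[n --> \oo] --> l2 ->
  series (quad_term (A - 1) (c - 1) w) n @[n --> \oo] -->
   l1 + k * w * l2.
Proof.
move=> c1 kE h1 h2.
have c0 : 4 * c * (c - 1) != 0 by rewrite gt_eqF // !mulr_gt0 //; lra.
(* The last series runs one index behind the others, since its factor [w] raises the degree by
   one. *)
have E : [sequence series (quad_term (A - 1) (c - 1) w) n.+1]_n =
   (fun n => series (quad_term A c w) n.+1 + k * w * series (quad_term (A + 1) (c + 1) w) n).
  apply/funext => n /=; elim: n => [|n IH].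
    by rewrite !seriesSr /series /= !big_geq // !quad_term0 mulr0 addr0.
  by rewrite seriesSr IH quad_term_contiguous // -kE [_ * k]mulrC mulfK // !seriesSr; ring.
rewrite -cvg_shiftS E; apply: cvgD; first by rewrite cvg_shiftS.
exact: cvgMr.
Qed.

(* Euler's transformation for 2F1 (mu - q / 2, mu + (1 - q) / 2; c; w), whose
   transform is a polynomial in w. Both sides obey the same contiguity
   recurrence in q. *)
Lemma cvg_quad_series mu w q c : 1 <= mu -> 0 < w < 1 -> 0 < c ->
  q%:R + c = mu + 1 / 2 -> exists2 l,
  series (quad_term (- q%:R) c w) n @[n --> \oo] --> l &
  series (quad_term (2 * mu - q%:R) c w) n @[n --> \oo] --> (1 - w) `^ (- mu) * l.
Proof.
move=> mu1 w01.
elim/ltn_ind: q c => -[|[|q]] IH c c0 qc.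
(* For q = 0 and q = 1 the polynomial is 1, and one upper parameter of the other 2F1 equals [c], so
   that the binomial series remains. *)
- exists 1.
    have := @cvg_series_finite (quad_term (- 0%:R) c w) 1.
    rewrite big_nat1 quad_term0; apply => i i1.
    by rewrite /quad_term pochhammer_oppn_eq0 ?mul0r; last lia.
  rewrite mulr1 (_ : quad_term _ _ _ = binomial_term mu w).
    exact: cvg_binomial_series.
  apply/funext => i.
  rewrite /quad_term subr0 pochhammer_double (_ : mu + 1 / 2 = c); last lra.
  rewrite /binomial_term; field.
  rewrite expf_neq0 ?pnatr_eq0 //= -lt0n fact_gt0.
  by rewrite gt_eqF ?pochhammer_gt0.
- exists 1.
    have := @cvg_series_finite (quad_term (- 1%:R) c w) 1.
    rewrite big_nat1 quad_term0; apply => i i1.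
    by rewrite /quad_term pochhammer_oppn_eq0 ?mul0r; last lia.
  rewrite mulr1 (_ : quad_term _ _ _ = binomial_term mu w).
    exact: cvg_binomial_series.
  apply/funext => i.
  rewrite /quad_term (_ : 2 * mu - 1 = 2 * c); last lra.
  rewrite pochhammer_double (_ : c + 1 / 2 = mu); last lra.
  rewrite /binomial_term; field.
  rewrite expf_neq0 ?pnatr_eq0 //= -lt0n fact_gt0.
  by rewrite gt_eqF ?pochhammer_gt0.
- have e1 : q.+1%:R + (c + 1) = mu + 1 / 2 by rewrite -qc -!natr1; ring.
  have e2 : q%:R + (c + 2) = mu + 1 / 2 by rewrite -qc -!natr1; ring.
  have [l1 h1 g1] := IH q.+1 (ltnSn _) (c + 1) (ltr_wpDr ler01 c0) e1.
  have [l2 h2 g2] := IH q (leqnSn _) (c + 2) (ltr_wpDr (ler0n _ _) c0) e2.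
  have c1 : 1 < c + 1 by lra.
  rewrite -natr1 in h1 g1.
  (* The contiguity coefficient at [c + 1] is invariant under A -> 2 c + 1 - A, which exchanges -(q
     + 1) and 2 mu - (q + 1). Hence one [k] serves both series. *)
  pose k : R := (q%:R + 1) * (2 * mu - (q%:R + 1)) / (4 * (c + 1) * c).
  have cE : c = mu + 1 / 2 - q%:R - 2 by rewrite -qc -!natr1; ring.
  have cc : 4 * (c + 1) * (c + 1 - 1) * k = (q%:R + 1) * (2 * mu - (q%:R + 1)).
    by rewrite /k; field; rewrite !gt_eqF //; lra.
  exists (l1 + k * w * l2).
    rewrite (_ : - q.+2%:R = - (q%:R + 1) - 1); last by rewrite -!natr1; ring.
    rewrite -[c in quad_term _ c](addrK 1); apply: cvg_quad_contiguous => //.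
      by rewrite cc cE; field.
    rewrite (_ : - (q%:R + 1) + 1 = - q%:R); last by ring.
    by rewrite -addrA.
  rewrite mulrDr mulrCA.
  rewrite (_ : 2 * mu - q.+2%:R = 2 * mu - (q%:R + 1) - 1); last by rewrite -!natr1; ring.
  rewrite -[c in quad_term _ c](addrK 1); apply: cvg_quad_contiguous => //.
    by rewrite cc cE; field.
  rewrite (_ : 2 * mu - (q%:R + 1) + 1 = 2 * mu - q%:R); last by ring.
  by rewrite -addrA.
Qed.

Lemma lim_quad_series mu w q c : 1 <= mu -> 0 < w < 1 -> 0 < c ->
  q%:R + c = mu + 1 / 2 ->
  limn (series (quad_term (2 * mu - q%:R) c w)) = (1 - w) `^ (- mu) *
   \sum_(0 <= j < (q./2).+1)
     q`!%:R / ((q - j.*2)`!%:R * 4 ^+ j * pochhammer c j * j`!%:R) * w ^+ j.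
Proof.
move=> mu1 w01 c0 qc; have [l h g] := cvg_quad_series mu1 w01 c0 qc.
rewrite (cvg_lim _ g) //; congr (_ * _).
have -> : l = \sum_(0 <= j < (q./2).+1) quad_term (- q%:R) c w j.
  apply: (cvg_unique _ h) => //; apply: cvg_series_finite => i qi.
  by rewrite /quad_term pochhammer_oppn_eq0 ?mul0r; last lia.
apply: eq_big_nat => j /andP[_ jq].
rewrite /quad_term pochhammer_oppn; last by lia.
rewrite -signr_odd odd_double expr0; field.
rewrite !pnatr_eq0 -!lt0n !fact_gt0 expf_neq0 ?pnatr_eq0 //=.
by rewrite gt_eqF ?pochhammer_gt0.
Qed.
End EulerTransformation.

(** * The Gamma function at positive integers *)

Section GammaNat.
Local Open Scope classical_set_scope.
Context {R : realType}.

(** Induction through the functional equation: raising the argument from N + 1 to N + 2 multiplies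
    the sequence by (N + 1) n / (n + N + 2), which tends to N + 1. *)
Lemma cvg_GammaS N :
  n`!%:R * n%:R `^ N.+1%:R / pochhammer (N.+1%:R : R) n.+1 @[n --> \oo]
    --> (N`!%:R : R).
Proof.
have fn0 k : k`!%:R != 0 :> R by rewrite pnatr_eq0 -lt0n fact_gt0.
have cvgratio (a : nat) : n%:R / (n%:R + a%:R + 1) @[n --> \oo] --> (1 : R).
  have -> : (fun n : nat => n%:R / (n%:R + a%:R + 1)) =
     (fun n : nat => 1 - (a%:R + 1) * ((n + a).+1%:R)^-1 : R).
    apply/funext => n; have : (n + a).+1%:R != 0 :> R by rewrite pnatr_eq0.
    by rewrite -natr1 natrD => h; field.
  have : (1 - (a%:R + 1) * ((n + a).+1%:R)^-1) @[n --> \oo] --> (1 - (a%:R + 1) * 0 : R).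
    apply: cvgB; first exact: cvg_cst.
    apply: cvgMr.
    have := @cvg_harmonic R; rewrite -(cvg_shiftn a); exact.
  by rewrite mulr0 subr0.
elim: N => [|N IH].
  rewrite [X in X @ _](_ : _ = (fun n : nat => n%:R / (n%:R + 0%:R + 1) : R)).
    exact: cvgratio.
  apply/funext => n.
  have -> : pochhammer (1 : R) n.+1 = n.+1`!%:R.
    by have := @pochhammer_natS R 0 n.+1; rewrite add0n fact0 divr1.
  have : n.+1%:R != 0 :> R by rewrite pnatr_eq0.
  rewrite powRr1 // addr0 factS natrM -natr1 => n0; field.
  by rewrite fn0 n0.
have : (N.+1%:R * (n%:R / (n%:R + N.+1%:R + 1)) *
    (n`!%:R * n%:R `^ N.+1%:R / pochhammer (N.+1%:R : R) n.+1)) @[n --> \oo]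
    --> (N.+1%:R * 1 * N`!%:R : R).
  by apply: cvgM => //; apply: cvgMr.
rewrite mulr1 -natrM -factS; apply: cvg_trans.
rewrite [X in X @ _ `=>` _](_ : _ = (fun n : nat => N.+1%:R * (n%:R / (n%:R + N.+1%:R + 1)) *
    (n`!%:R * n%:R `^ N.+1%:R / pochhammer (N.+1%:R : R) n.+1))) //.
apply/funext => n.
rewrite !powR_mulrn // exprS !pochhammer_natS.
rewrite (_ : N.+1 + n.+1 = (N + n.+1).+1)%N // factS (factS N) !natrM.
have : (N + n.+1).+1%:R != 0 :> R by rewrite pnatr_eq0.
have : N.+1%:R != 0 :> R by rewrite pnatr_eq0.
rewrite -!natr1 natrD -!natr1 => h1; rewrite addrCA addrA => h2; field.
by rewrite h1 h2 !fn0.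
Qed.

Lemma Gamma_natS N : Gamma (N.+1%:R : R) = N`!%:R.
Proof. exact/cvg_lim/cvg_GammaS. Qed.
End GammaNat.

(** * Expansion in Gegenbauer polynomials *)

Lemma sum_triangle (V : nmodType) (F : nat -> nat -> V) M :
  \sum_(0 <= j < M.+1) \sum_(0 <= i < (M - j).+1) F j i =
  \sum_(0 <= s < M.+1) \sum_(0 <= j < s.+1) F j (s - j)%N.
Proof.
elim: M => [|M IH]; first by rewrite !big_nat1.
rewrite [RHS]big_nat_recr //= -IH big_nat_recr //= subnn big_nat1.
rewrite [X in _ = _ + X]big_nat_recr //= subnn addrA; congr (_ + _).
rewrite -big_split; apply: eq_big_nat => j /andP[_ jM] /=.
by rewrite subSn // big_nat_recr.
Qed.

(** The substitution N = n + 2 j; both sides are brought to a form with [j] as the outer index. *)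
Lemma sum_antidiag2 (V : nmodType) (F : nat -> nat -> V) p :
  \sum_(0 <= n < p.+1) \sum_(0 <= j < ((p - n)./2).+1) F n j =
  \sum_(0 <= N < p.+1) \sum_(0 <= j < (N./2).+1) F (N - j.*2)%N j.
Proof.
transitivity (\sum_(0 <= j < p.+1) \sum_(0 <= n < p.+1 | (n + j.*2 <= p)%N) F n j).
  rewrite (exchange_big_dep_nat xpredT) //=; apply: eq_big_nat => n /andP[_ np].
  rewrite [RHS](big_nat_widenl _ 0) // [LHS](big_nat_widen _ _ p.+1); last by lia.
  by apply: eq_bigl => j; lia.
symmetry.
transitivity (\sum_(0 <= j < p.+1) \sum_(0 <= N < p.+1 | (j.*2 <= N)%N) F (N - j.*2)%N j).
  rewrite (exchange_big_dep_nat xpredT) //=; apply: eq_big_nat => n /andP[_ np].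
  rewrite [LHS](big_nat_widen _ _ p.+1); last by lia.
  by apply: eq_bigl => j; lia.
apply: eq_big_nat => j _.
case: (leqP j.*2 p) => jp; last first.
  by rewrite [LHS]big_nat_cond [RHS]big_nat_cond !big_pred0 // => i; lia.
transitivity (\sum_(j.*2 <= N < p.+1) F (N - j.*2)%N j).
  by rewrite [RHS](big_nat_widenl _ 0%N).
have := big_addn 0 p.+1 j.*2 xpredT (fun N => F (N - j.*2)%N j).
rewrite add0n => ->.
rewrite [RHS](_ : _ = \sum_(0 <= i < p.+1 - j.*2) F i j); first by apply: eq_bigr => i _; rewrite addnK.
rewrite [RHS](big_nat_widen _ _ p.+1); last by lia.
by apply: eq_bigl => i; lia.
Qed.

(* The right-hand side, as a function of J, is the antidifference of the
   summand given by Gosper's algorithm. *)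
Lemma alternating_fact_telescope (R : numFieldType) (L s J : nat) :
  (0 < J <= s)%N -> (s.*2 < L)%N ->
  \sum_(0 <= j < J) (-1) ^+ j * (L - j.*2)%:R * (L - j - s).-1`!%:R /
    ((s - j)`! * j`! * (L - j)`!)%:R =
  (-1) ^+ J.+1 * (L - J - s)`!%:R / (s%:R * ((s - J)`! * J.-1`! * (L - J)`!)%:R) :> R.
Proof.
have fn0 n : n`!%:R != 0 :> R by rewrite pnatr_eq0 -lt0n fact_gt0.
case: J => // J /= Js sL.
have s0 : s%:R != 0 :> R by rewrite pnatr_eq0; lia.
elim: J Js => [|J IH] Js.
  rewrite big_nat1 !subn0 fact0 expr0 mul1r.
  have [l Ll] : exists l, L = (l + s).+1 by exists (L - s).-1; lia.
  have [t st] : exists t, s = t.+1 by exists s.-1; lia.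
  rewrite Ll (_ : ((l + s).+1 - s).-1 = l)%N; last by lia.
  rewrite (_ : (_ - 1 - s = l)%N); last by lia.
  rewrite (_ : ((l + s).+1 - 1 = l + s)%N); last by lia.
  rewrite (_ : (s - 1 = t)%N); last by lia.
  have sf : s`! = (s * t`!)%N by rewrite st factS.
  rewrite factS sf !natrM expr2.
  have : (l + s).+1%:R != 0 :> R by rewrite pnatr_eq0.
  rewrite -natr1 natrD => ls0; field.
  by rewrite s0 !fn0 ls0.
rewrite big_nat_recr //= IH; last by lia.
have [t st] : exists t, s = (t + J).+2 by exists (s - J.+2)%N; lia.
have [l Ll] : exists l, L = (l + s + J).+2 by exists (L - (s + J).+2)%N; lia.
rewrite (_ : (L - J.+1 - s = l.+1)%N); last by lia.
rewrite (_ : (L - J.+2 - s = l)%N); last by lia.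
rewrite (_ : (L - J.+1 = (l + s).+1)%N); last by lia.
rewrite (_ : (L - J.+2 = (l + s))%N); last by lia.
rewrite (_ : (s - J.+1 = t.+1)%N); last by lia.
rewrite (_ : (s - J.+2 = t)%N); last by lia.
rewrite (_ : (L - J.+1.*2 = (l + t).+2)%N); last by lia.
rewrite /= !factS !natrM.
have n0 n : n.+1%:R != 0 :> R by rewrite pnatr_eq0.
have := n0 l; have := n0 t; have := n0 (l + s)%N; have := n0 J.
move: s0; rewrite st -!natr1 !natrD -!natr1 !natrD !exprS => h1 h2 h3 h4 h5; field.
by rewrite !fn0 ?h1 ?h2 ?h3 ?h4 ?h5.
Qed.

(** For positive [s], the telescoped sum over j < s cancels the term j = s. This is the inversion
    relation that removes the lower powers of X in [monomial_gegenbauer]. *)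
Lemma alternating_fact_sum (R : numFieldType) (L s : nat) : (s.*2 < L)%N ->
  \sum_(0 <= j < s.+1) (-1) ^+ (s - j) * (L - j.*2)%:R * (L - j - s).-1`!%:R /
    ((s - j)`! * j`! * (L - j)`!)%:R = (s == 0%N)%:R :> R.
Proof.
have fn0 n : n`!%:R != 0 :> R by rewrite pnatr_eq0 -lt0n fact_gt0.
case: s => [|s] sL.
  rewrite big_nat1 !subn0 expr0 fact0 !mul1n mul1r.
  case: L sL => // L _; rewrite factS natrM mulfV // mulf_neq0 // pnatr_eq0 //.
transitivity ((-1) ^+ s.+1 * \sum_(0 <= j < s.+2)
    (-1) ^+ j * (L - j.*2)%:R * (L - j - s.+1).-1`!%:R / ((s.+1 - j)`! * j`! * (L - j)`!)%:R : R).
  rewrite mulr_sumr; apply: eq_big_nat => j /andP[_ js].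
  by rewrite -signr_odd oddB// signr_addb !signr_odd !mulrA.
rewrite big_nat_recr //= alternating_fact_telescope //; last by lia.
rewrite subnn fact0 !mul1n.
have [l ->] : exists l, L = (l + s.*2 + 2).+1 by exists (L - s.*2 - 3)%N; lia.
rewrite (_ : (_ - s.+1 - s.+1 = l.+1)%N); last by lia.
rewrite (_ : (_ - s.+1 = (l + s.+2))%N); last by lia.
rewrite (_ : (_ - s.+1.*2 = l.+1)%N); last by lia.
rewrite /= factS (factS s) !natrM [(-1) ^+ s.+2]exprS.
have s0 : s.+1%:R != 0 :> R by rewrite pnatr_eq0.
move: s0; rewrite -natr1 => s0.
rewrite [X in _ * X](_ : _ = 0) ?mulr0 //; field.
by rewrite s0 !fn0.
Qed.

Lemma horner_gegenbauer_natS (R : realType) (n l : nat) (X : R) :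
  (gegenbauer n l.+1%:R).[X] =
  \sum_(0 <= i < (n./2).+1) (-1) ^+ i * (l + (n - i))`!%:R / l`!%:R
    / (i`! * (n - i.*2)`!)%:R * (2 * X) ^+ (n - i.*2).
Proof.
rewrite /gegenbauer horner_sum big_mkord; apply: eq_bigr => i _.
by rewrite hornerZ horner_exp hornerZ hornerX pochhammer_natS mul2n !mulrA.
Qed.

(** Inserting the explicit Gegenbauer polynomials and collecting the power (2 X)^(N - 2 s) gives the
    sum of [alternating_fact_sum] as its coefficient, so only s = 0 survives. *)
Lemma monomial_gegenbauer (R : realType) (N l : nat) (X : R) :
  (2 * X) ^+ N / N`!%:R = l`!%:R * \sum_(0 <= j < (N./2).+1)
    (N - j.*2 + l.+1)%:R * (gegenbauer (N - j.*2) l.+1%:R).[X]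
      / (j`! * (N - j + l.+1)`!)%:R.
Proof.
have fn0 n : n`!%:R != 0 :> R by rewrite pnatr_eq0 -lt0n fact_gt0.
(* With this [L], the weight of the polynomial of degree N - 2 j, its degree plus its parameter
   [l.+1], is L - 2 j. *)
pose L := (N + l.+1)%N.
pose G j i : R := (2 * X) ^+ (N - (j + i).*2) / (N - (j + i).*2)`!%:R *
  ((-1) ^+ i * (L - j.*2)%:R * (L - j - (j + i)).-1`!%:R / (i`! * j`! * (L - j)`!)%:R).
transitivity (\sum_(0 <= j < (N./2).+1) \sum_(0 <= i < (N./2 - j).+1) G j i).
  rewrite sum_triangle.
  transitivity (\sum_(0 <= s < (N./2).+1)
    (2 * X) ^+ (N - s.*2) / (N - s.*2)`!%:R * (s == 0%N)%:R); last first.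
    apply: eq_big_nat => s /andP[_ sN].
    rewrite -(@alternating_fact_sum R L) ?mulr_sumr; last by rewrite /L; lia.
    by apply: eq_big_nat => j /andP[_ js]; rewrite /G subnKC.
  rewrite big_nat_recl // double0 subn0 mulr1 big1 ?addr0 // => i _.
  by rewrite mulr0.
rewrite mulr_sumr; apply: eq_big_nat => j /andP[_ jN].
rewrite horner_gegenbauer_natS mulr_sumr mulr_suml mulr_sumr.
rewrite (_ : (N - j.*2)./2 = N./2 - j)%N; last by lia.
apply: eq_big_nat => i /andP[_ iN].
rewrite /G /L.
rewrite (_ : (N + l.+1 - j.*2 = N - j.*2 + l.+1)%N); last by lia.
rewrite (_ : (N + l.+1 - j = N - j + l.+1)%N); last by lia.
rewrite (_ : (N - (j + i).*2 = N - j.*2 - i.*2)%N); last by lia.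
rewrite (_ : (N - j + l.+1 - (j + i)).-1 = l + (N - j.*2 - i))%N; last by lia.
rewrite !natrM; field.
by rewrite !fn0.
Qed.

Lemma expr_sub_gegenbauer (R : realType) (p l : nat) (z X : R) :
  (z - X) ^+ p = p`!%:R * l`!%:R * \sum_(0 <= n < p.+1)
    ((-1) ^+ n * (n + l.+1)%:R * (gegenbauer n l.+1%:R).[X] *
     \sum_(0 <= j < ((p - n)./2).+1) z ^+ (p - n - j.*2) /
       ((p - n - j.*2)`! * (j`! * (n + j + l.+1)`!) * 2 ^ (n + j.*2))%:R).
Proof.
have fn0 n : n`!%:R != 0 :> R by rewrite pnatr_eq0 -lt0n fact_gt0.
have e2 n : 2 ^+ n != 0 :> R by rewrite expf_neq0 // pnatr_eq0.
under eq_bigr do rewrite mulr_sumr.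
(* The outer index becomes the exponent N of X, so both sides can be compared for each N. *)
rewrite sum_antidiag2 exprBn_comm; last exact: mulrC.
rewrite -(big_mkord xpredT (fun i => ((-1) ^+ i * z ^+ (p - i) * X ^+ i) *+ 'C(p, i))).
rewrite mulr_sumr; apply: eq_big_nat => N /andP[_ Np].
have -> : X ^+ N = N`!%:R / 2 ^+ N * ((2 * X) ^+ N / N`!%:R).
  by rewrite exprMn; field; rewrite fn0 e2.
rewrite (monomial_gegenbauer _ l) -mulr_natr.
have -> : 'C(p, N)%:R = p`!%:R / (N`!%:R * (p - N)`!%:R) :> R.
  rewrite -(bin_fact (n := p) (m := N)) // !natrM; field.
  by rewrite !fn0.
rewrite !mulrA -[LHS]mulrA mulrC !mulrA !mulr_sumr.
apply: eq_big_nat => j /andP[_ jN].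
have jN2 : (j.*2 <= N)%N by lia.
rewrite (_ : (p - (N - j.*2) - j.*2 = p - N)%N); last by lia.
rewrite (_ : (N - j.*2 + j + l.+1 = N - j + l.+1)%N); last by lia.
rewrite subnK // -[(-1) ^+ (N - j.*2)]signr_odd oddB // odd_double addbF signr_odd.
rewrite !natrM natrX; field.
by rewrite !fn0 e2.
Qed.

(** * The Legendre function and the phase *)

(** Here [l] stands for d / 2 - 2. The two powers of [s] make s^(2 mu), which cancels against
    Euler's factor (1 - w)^(- mu) = (z / s)^(2 mu). Since nu + mu + 1 = 2 mu - (p - n), what is left
    of [z] is z^(p - n) times a polynomial in z^(-2). Both Gamma arguments are positive integers. *)
Lemma legendreQ_half_integer (R : realType) (n p l : nat) (nu mu z s : R) :
  (n <= p)%N -> 0 < s -> 1 < z -> z ^+ 2 - 1 = s ^+ 2 ->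
  nu = n%:R + l%:R + 1 / 2 -> mu = p%:R + l%:R + 3 / 2 ->
  s `^ mu *
  (Num.sqrt pi * Gamma (nu + mu + 1) * (z ^+ 2 - 1) `^ (mu / 2)
   / (2 `^ (nu + 1) * Gamma (nu + 3 / 2) * z `^ (nu + mu + 1))
   * hyp2F1 ((nu + mu + 1) / 2) ((nu + mu + 2) / 2) (nu + 3 / 2)
       (1 / z ^+ 2)) =
  Num.sqrt pi * (n + p + l.*2 + 2)`!%:R / 2 `^ (l%:R + 3 / 2) *
  ((p - n)`!%:R * \sum_(0 <= j < ((p - n)./2).+1) z ^+ (p - n - j.*2) /
       ((p - n - j.*2)`! * (j`! * (n + j + l.+1)`!) * 2 ^ (n + j.*2))%:R).
Proof.
move=> np s0 z1 zs nuE muE.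
have fn0 k : k`!%:R != 0 :> R by rewrite pnatr_eq0 -lt0n fact_gt0.
have e2 k : 2 ^+ k != 0 :> R by rewrite expf_neq0 // pnatr_eq0.
have z0 : 0 < z by lra.
have nz0 : z != 0 by rewrite gt_eqF.
set w := 1 / z ^+ 2.
have w01 : 0 < w < 1.
  by rewrite /w div1r invr_gt0 exprn_gt0 //= invf_lt1 ?exprn_gt0 // exprn_egt1.
have mu1 : 1 <= mu by have := ler0n R p; have := ler0n R l; rewrite muE; lra.
have cE : nu + 3 / 2 = (n + l.+1).+1%:R.
  by rewrite nuE -!natr1 natrD -!natr1; field.
have aE : nu + mu + 1 = (n + p + l.*2 + 2).+1%:R.
  by rewrite nuE muE -!natr1 !natrD -muln2 natrM; field.
have qc : (p - n)%:R + (nu + 3 / 2) = mu + 1 / 2.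
  by rewrite natrB // nuE muE; field.
have hE : hyp2F1 ((nu + mu + 1) / 2) ((nu + mu + 2) / 2) (nu + 3 / 2) w =
    (1 - w) `^ (- mu) * \sum_(0 <= j < ((p - n)./2).+1)
     (p - n)`!%:R / ((p - n - j.*2)`!%:R * 4 ^+ j * pochhammer (nu + 3 / 2) j * j`!%:R) * w ^+ j.
  rewrite -lim_quad_series //; last by rewrite cE.
  congr (limn (series _)); apply/funext => i; rewrite /quad_term.
  rewrite (_ : 2 * mu - (p - n)%:R = 2 * ((nu + mu + 1) / 2)); last first.
    by rewrite natrB // nuE muE; field.
  rewrite pochhammer_double (_ : (nu + mu + 1) / 2 + 1 / 2 = (nu + mu + 2) / 2); last by field.
  field; rewrite fn0 expf_neq0 ?pnatr_eq0 // andbT.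
  by rewrite gt_eqF // pochhammer_gt0 // cE.
set S := s `^ mu; set Z := z `^ mu.
have S0 : S != 0 by rewrite gt_eqF // powR_gt0.
have Z0 : Z != 0 by rewrite gt_eqF // powR_gt0.
have w1 : 0 <= 1 - w by lra.
have pw : (1 - w) `^ (- mu) = Z * Z / (S * S).
  have E : (1 - w) * (z * z) = s * s.
    by rewrite -[s * s]expr2 -zs /w; field.
  have E' : (1 - w) `^ mu * (Z * Z) = S * S.
    by rewrite /S /Z -!powRM ?mulr_ge0 ?(ltW s0) ?(ltW z0) // E.
  rewrite powRN -E'; field; rewrite Z0 gt_eqF // powR_gt0 //; lra.
have ps : (z ^+ 2 - 1) `^ (mu / 2) = S.
  by rewrite zs -powR_mulrn ?ltW // -powRrM mulrC divfK ?pnatr_eq0.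
have pz : z `^ (nu + mu + 1) = Z * Z / z ^+ (p - n).
  apply: (canRL (mulfK _)); first by rewrite expf_neq0.
  rewrite -powR_mulrn ?ltW // -!powRD; try by apply/implyP => _.
  by congr (_ `^ _); rewrite natrB // nuE muE; field.
have p2 : 2 `^ (nu + 1) = 2 ^+ n * 2 `^ (l%:R + 3 / 2) :> R.
  rewrite -powR_mulrn // -powRD; last by apply/implyP => _; rewrite pnatr_eq0.
  by congr (_ `^ _); rewrite nuE; field.
have q0 : 2 `^ (l%:R + 3 / 2) != 0 :> R by rewrite gt_eqF // powR_gt0.
rewrite hE pw ps pz p2 aE cE !Gamma_natS !mulr_sumr.
apply: eq_big_nat => j /andP[_ jq].
rewrite pochhammer_natS (_ : (n + l.+1 + j = n + j + l.+1)%N); last by lia.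
(* The factor z^(2 j) absorbs w^j; below, 2^n from the denominator of Q and 4^j combine into 2^(n +
   2 j). *)
have -> : z ^+ (p - n) = z ^+ (p - n - j.*2) * (z ^+ 2) ^+ j.
  by rewrite -exprM mul2n -exprD subnK //; lia.
rewrite /w expr_div_n expr1n !natrM natrX exprD -(mul2n j) exprM.
rewrite (_ : 2 ^+ 2 = 4 :> R); last by ring.
field.
by rewrite !fn0 e2 q0 S0 Z0 !expf_neq0 ?pnatr_eq0.
Qed.

Lemma cis_pi_half (R : realType) (N : nat) :
  cis (pi * (N%:R + 1 / 2)) = (-1) ^+ N * 'i%C :> R[i].
Proof.
elim: N => [|N IH].
  by rewrite add0r div1r /cis cos_pihalf sin_pihalf mul1r.
rewrite exprS mulN1r mulNr -IH /cis -natr1 addrAC mulrDr mulr1 cosDpi sinDpi.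
by [].
Qed.

(** * Squared distances and the assembly of the expansion *)

Lemma dotpB (R : realType) (d : nat) (x y : 'rV[R]_d) :
  dotp (x - y) (x - y) = dotp x x + dotp y y - 2 * dotp x y.
Proof.
rewrite /dotp mulr_sumr -big_split -sumrB /=; apply: eq_bigr => i _.
by rewrite !mxE; ring.
Qed.

Lemma sqr_enorm (R : realType) (d : nat) (x : 'rV[R]_d) : enorm x ^+ 2 = dotp x x.
Proof.
by rewrite /enorm sqr_sqrtr // sumr_ge0 // => i _; rewrite -expr2 sqr_ge0.
Qed.

Theorem theorem5p4 (R : realType) (d k p : nat)
    (hd : (4 <= d)%N) (hdeven : ~~ odd d)
    (hk : (1 <= k)%N) (hp : p%:Z = k%:Z - (d./2)%:Z)
    (x x' : 'rV[R]_d) (r r' : R) (hr : r = enorm x) (hr' : r' = enorm x')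
    (r_gt0 : 0 < r) (r'_gt0 : 0 < r') (r_neq : r <> r')
    (rmax rmin zeta : R)
    (hrmax : rmax = Num.max r r') (hrmin : rmin = Num.min r r')
    (hzeta : zeta = (r ^+ 2 + r' ^+ 2) / (2 * r * r'))
    (gamma : R) (gamma_itv : 0 <= gamma <= pi)
    (cos_gamma : cos gamma = dotp x x' / (r * r')) :
  (enorm (x - x') ^ (2 * k%:Z - d%:Z))%:C =
  'i%C * (-1) ^ (p%:Z - (d./2)%:Z)
  * (2 `^ ((d%:R - 1) / 2) / Num.sqrt pi * p`!%:R * (d./2 - 2)`!%:R
     * (2 * r * r') ^+ p
     * ((rmax ^+ 2 - rmin ^+ 2) / (2 * r * r')) `^ (p%:R + (d%:R - 1) / 2))%:C
  * \sum_(0 <= n < p.+1)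
      ((-1) ^+ n * (n%:R + d%:R / 2 - 1)
       * (gegenbauer n (d%:R / 2 - 1)).[cos gamma]
       / ((p - n)`!%:R * (n + p + d - 2)`!%:R))%:C
      * legendreQ (n%:R + (d%:R - 3) / 2) (p%:R + (d%:R - 1) / 2) zeta.
Proof.
(* Writing d = 2 (l + 2) turns the Gegenbauer parameter d / 2 - 1 into [l.+1] and (d / 2 - 2)! into
   [l]!. *)
have [l dE] : exists l, d = (l + 2).*2 by exists (d./2 - 2)%N; lia.
have d2 : d./2 = (l + 2)%N by rewrite dE doubleK.
have kE : k = (p + l + 2)%N by lia.
have dR : d%:R = 2 * (l%:R + 2) :> R by rewrite dE -mul2n natrM natrD.
have rr : 0 < 2 * r * r' by rewrite !mulr_gt0.
have r0 : r != 0 by rewrite gt_eqF.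
have r'0 : r' != 0 by rewrite gt_eqF.
set s := (rmax ^+ 2 - rmin ^+ 2) / (2 * r * r').
have s_gt0 : 0 < s.
  rewrite /s divr_gt0 // subr_gt0 hrmax hrmin.
  case: (ltgtP r r') r_neq => [lt _|lt _|//];
    by rewrite ltr_pXn2r ?nnegrE ?ltW // lt_max gt_min lt ?orbT.
(* This is (r^2 + r'^2)^2 - 4 r^2 r'^2 = (r^2 - r'^2)^2, in either order of the radii. *)
have zs : zeta ^+ 2 - 1 = s ^+ 2.
  rewrite /s hzeta hrmax hrmin; case: (lerP r r') => _; by field; rewrite r0 r'0.
have z1 : 1 < zeta.
  have z0 : 0 < zeta by rewrite hzeta divr_gt0 // addr_gt0 // exprn_gt0.
  rewrite -(ltr_pXn2r (n := 2)) ?nnegrE ?ltW // expr1n -subr_gt0 zs.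
  by rewrite exprn_gt0.
have dist : enorm (x - x') ^+ 2 = 2 * r * r' * (zeta - cos gamma).
  rewrite sqr_enorm dotpB -!sqr_enorm -hr -hr' cos_gamma hzeta; field.
  by rewrite r0 r'0.
(* The exponent is 2 p, so the distance enters only through its square. *)
have -> : (2 * k%:Z - d%:Z) = (2 * p)%N%:Z by lia.
rewrite -exprnP exprM dist exprMn (expr_sub_gegenbauer p l).
set mu := p%:R + (d%:R - 1) / 2.
have muE : mu = p%:R + l%:R + 3 / 2 by rewrite /mu dR; field.
have cE : cis (pi * mu) = (-1) ^+ (p + l + 1) * 'i%C :> R[i].
  rewrite -cis_pi_half; congr (cis (pi * _)).
  by rewrite muE !natrD; field.
(* The two factors i give -1, and the powers of -1 combine to the odd exponent 2 p + 2 l + 3. *)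
have phase : 'i%C * (-1) ^ (p%:Z - (d./2)%:Z) * cis (pi * mu) = 1 :> R[i].
  rewrite cE d2 expfzDr ?oppr_eq0 ?oner_eq0 // -exprz_inv invrN1 -!exprnP.
  transitivity ('i%C ^+ 2 * (-1) ^+ (p + (l + 2) + (p + l + 1)) : R[i]).
    by rewrite !exprD; ring.
  rewrite sqr_i -signr_odd (_ : odd _ = true); last by lia.
  by rewrite expr1 mulrNN mulr1.
set C : R := _ * s `^ _.
pose Q n : R := let nu := n%:R + (d%:R - 3) / 2 in
  Num.sqrt pi * Gamma (nu + mu + 1) * (zeta ^+ 2 - 1) `^ (mu / 2)
   / (2 `^ (nu + 1) * Gamma (nu + 3 / 2) * zeta `^ (nu + mu + 1))
   * hyp2F1 ((nu + mu + 1) / 2) ((nu + mu + 2) / 2) (nu + 3 / 2)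
       (1 / zeta ^+ 2).
pose a n : R := (-1) ^+ n * (n%:R + d%:R / 2 - 1)
       * (gegenbauer n (d%:R / 2 - 1)).[cos gamma]
       / ((p - n)`!%:R * (n + p + d - 2)`!%:R).
(* The phase depends on [mu] alone, so it leaves the sum over n and the summands become real. *)
rewrite [X in _ = _ * X](_ : _ = cis (pi * mu) * (\sum_(0 <= n < p.+1) a n * Q n)%:C); last first.
  rewrite rmorph_sum mulr_sumr; apply: eq_bigr => n _.
  transitivity ((a n)%:C * (cis (pi * mu) * (Q n)%:C)); first by [].
  by rewrite mulrCA -rmorphM.
transitivity (C * \sum_(0 <= n < p.+1) a n * Q n)%:C; last first.
  by rewrite mulrACA phase mul1r -rmorphM.
congr (_%:C); rewrite mulrA [LHS]mulr_sumr [RHS]mulr_sumr.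
apply: eq_big_nat => n /andP[_ np].
have nuE : n%:R + (d%:R - 3) / 2 = n%:R + l%:R + 1 / 2 :> R by rewrite dR; field.
have := legendreQ_half_integer (np : (n <= p)%N) s_gt0 z1 zs nuE muE.
rewrite -/(Q n) => QE.
(* The power of [s] is taken out of the prefactor and attached to [Q n], as [legendreQ_half_integer]
   requires. *)
have -> : C * (a n * Q n) = 2 `^ ((d%:R - 1) / 2) / Num.sqrt pi * p`!%:R *
    (d./2 - 2)`!%:R * (2 * r * r') ^+ p * a n * (s `^ mu * Q n).
  by rewrite /C; ring.
rewrite QE /a d2 addnK (_ : (n + p + d - 2 = n + p + l.*2 + 2)%N); last by lia.
rewrite (_ : d%:R / 2 - 1 = l.+1%:R); last by rewrite dR -natr1; field.
rewrite (_ : n%:R + d%:R / 2 - 1 = (n + l.+1)%:R); last by rewrite natrD dR -natr1; field.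
rewrite (_ : (d%:R - 1) / 2 = l%:R + 3 / 2); last by rewrite dR; field.
have sqrt_pi : Num.sqrt pi != 0 :> R by rewrite gt_eqF // sqrtr_gt0 pi_gt0.
have pow2 : 2 `^ (l%:R + 3 / 2) != 0 :> R by rewrite gt_eqF // powR_gt0.
have fn0 m : m`!%:R != 0 :> R by rewrite pnatr_eq0 -lt0n fact_gt0.
field.
by rewrite sqrt_pi pow2 !fn0.
Qed.
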